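(* Let $a,b$ be integers and let $(u_n)_{n\ge 0}$ be the integer sequence with $u_0=0$, $u_1=1$, $u_{n+2}=a u_{n+1}+b u_n$ for all $n\ge 0$, assumed nondegenerate ($b\neq 0$ and the ratio of the two complex roots of $x^2-ax-b$ is not a root of unity). Let $\Delta:=a^2+4b$. Let $p$ be a prime number not dividing $b$, and let $r$ be the rank of the $p$-regular sequence $\nu_p(u_{n+1})_{n\ge 0}$. Then: (i) If $p\mid\Delta$: $r=2$ if either $p\in\{2,3\}$ and $\nu_p(u_p)=1$, or $p\ge 5$; and $r=3$ if $p\in\{2,3\}$ and $\nu_p(u_p)\neq 1$. (ii) If $p\nmid\Delta$: $r=5$ if $p=2$ and $\nu_2(u_6)\neq \nu_2(u_3)+1$; and $r=\tau(p)+1$ if $p>2$, or if $p=2$ and $\nu_2(u_6)=\nu_2(u_3)+1$.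
   Context: $\nu_p(n)$ is the usual $p$-adic valuation of a nonzero integer $n$. For a positive integer $m$ coprime to $b$, $\tau(m)$ (the rank of apparition of $m$) is the least positive integer $n$ with $m\mid u_n$. For a sequence of integers $s(n)_{n\ge 0}$, its $p$-kernel is the set of subsequences $\{s(p^e n+i)_{n\ge 0} : e\ge 0,\ 0\le i<p^e\}$; the sequence is $p$-regular if the $\mathbb{Z}$-module generated by its $p$-kernel is finitely generated, and its rank is then the rank of that $\mathbb{Z}$-module. *)

(* Defs.v *)
From mathcomp Require Import all_boot all_order all_algebra all_field.

Set Implicit Arguments.
Unset Strict Implicit.
Unset Printing Implicit Defensive.

Import GRing.Theory.
Local Open Scope ring_scope.

Fixpoint lucas (a b : int) (n : nat) : int :=
  match n with
  | 0 => 0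
  | 1 => 1
  | (n'.+1 as m).+1 => a * lucas a b m + b * lucas a b n'
  end.

Definition lucas_disc (a b : int) : int := a ^+ 2 + 4 * b.

(* The complex roots of the integral polynomial are algebraic, so they are
   taken, with multiplicity, in [algC]; as [algC] is algebraically closed, the
   quantification over [alpha] and [beta] is never vacuous. *)
Definition lucas_nondegenerate (a b : int) : Prop :=
  b <> 0 /\
  forall alpha beta : algC,
    'X^2 - (a%:~R)%:P * 'X - (b%:~R)%:P = ('X - alpha%:P) * ('X - beta%:P) ->
    forall k : nat, (0 < k)%N -> (alpha / beta) ^+ k <> 1.

(* Meaningful for nonzero [x] only: [padic_val p 0 = 0]. *)
Definition padic_val (p : nat) (x : int) : nat := logn p `|x|%N.

Definition is_apparition_rank (a b : int) (m t : nat) : Prop :=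
  [/\ (0 < t)%N,
      (m %| lucas a b t)%Z
    & forall n : nat, (0 < n)%N -> (m %| lucas a b n)%Z -> (t <= n)%N].

(* Integer sequences are compared pointwise; sets of sequences are predicates. *)
Definition in_kernel (p : nat) (s t : nat -> int) : Prop :=
  exists e i : nat, (i < p ^ e)%N /\ forall n : nat, t n = s (p ^ e * n + i)%N.

Definition in_Zspan (S : (nat -> int) -> Prop) (t : nat -> int) : Prop :=
  exists (k : nat) (g : 'I_k -> nat -> int) (c : 'I_k -> int),
    (forall i, S (g i)) /\ forall n : nat, t n = \sum_(i < k) c i * g i n.

Definition kernel_module (p : nat) (s : nat -> int) : (nat -> int) -> Prop :=
  in_Zspan (in_kernel p s).

Definition finitely_generated (M : (nat -> int) -> Prop) : Prop :=
  exists (k : nat) (g : 'I_k -> nat -> int),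
    (forall i, M (g i)) /\
    forall t, M t ->
      exists c : 'I_k -> int, forall n : nat, t n = \sum_(i < k) c i * g i n.

Definition Zfree (k : nat) (g : 'I_k -> nat -> int) : Prop :=
  forall c : 'I_k -> int,
    (forall n : nat, \sum_(i < k) c i * g i n = 0) -> forall i, c i = 0.

(* The rank of a module is the largest size of a linearly independent family. *)
Definition has_rank (M : (nat -> int) -> Prop) (r : nat) : Prop :=
  (exists g : 'I_r -> nat -> int, (forall i, M (g i)) /\ Zfree g) /\
  forall (k : nat) (g : 'I_k -> nat -> int),
    (forall i, M (g i)) -> Zfree g -> (k <= r)%N.

Definition p_regular (p : nat) (s : nat -> int) : Prop :=
  finitely_generated (kernel_module p s).

Definition p_regular_rank (p : nat) (s : nat -> int) (r : nat) : Prop :=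
  p_regular p s /\ has_rank (kernel_module p s) r.

Definition lucas_val (a b : int) (p n : nat) : int :=
  (padic_val p (lucas a b n.+1))%:Z.

(* Main.v *)
(* By the law of apparition and the binomial expansion of the powers of the
   companion matrix, there are [t] prime to [p] and constants [h0], [h1] such
   that nu_p(u_n) is [0] when [t] does not divide [n], and otherwise
   nu_p(n) + h1 or [h0] according to whether [p] divides [n]: [t = 1] and
   [h0 = 0] if [p] divides the discriminant, [t] is the rank of apparition
   otherwise, and then [h0 = h1] as soon as [p] is odd.
   An element of the kernel of such a sequence s is s itself, a translate by a
   periodic sequence of V(n) = s(p n + p - 1), or a sequence of period [t]. All
   the indicators of residue classes mod [t] occur up to a nonzero factor, so
   the rank is [t + 1] if s is V up to a periodic sequence, that is if
   [h0 = h1], and [t + 2] otherwise. *)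

Require Import Defs.
From mathcomp Require Import all_boot all_order all_algebra all_field.
From mathcomp.classical Require Import boolp.
From mathcomp Require Import fingroup ring zify.
Import Order.TTheory GRing.Theory Num.Theory.
Local Open Scope ring_scope.

(** * Submodules of finitely generated modules of sequences *)

Definition cat_family {T : Type} {m n : nat} (F : 'I_m -> T) (G : 'I_n -> T)
  (i : 'I_(m + n)) : T :=
  match split i with inl j => F j | inr j => G j end.

Lemma cat_family_lshift T m n (F : 'I_m -> T) (G : 'I_n -> T) i :
  cat_family F G (lshift n i) = F i.
Proof. by rewrite /cat_family (unsplitK (inl i)). Qed.

Lemma cat_family_rshift T m n (F : 'I_m -> T) (G : 'I_n -> T) i :
  cat_family F G (rshift m i) = G i.
Proof. by rewrite /cat_family (unsplitK (inr i)). Qed.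

Lemma sum_cat_family m k (c : 'I_(m + k) -> int)
    (F : 'I_m -> nat -> int) (G : 'I_k -> nat -> int) n :
  \sum_i c i * cat_family F G i n =
  \sum_i c (lshift k i) * F i n + \sum_i c (rshift m i) * G i n.
Proof.
rewrite big_split_ord /=; congr (_ + _); apply: eq_bigr => i _.
  by rewrite cat_family_lshift.
by rewrite cat_family_rshift.
Qed.

Lemma in_Zspan_gen (S : (nat -> int) -> Prop) t : S t -> in_Zspan S t.
Proof.
move=> St; exists 1%N, (fun=> t), (fun=> 1); split=> // n.
by rewrite big_ord1 mul1r.
Qed.

Lemma in_Zspan_subZ (S : (nat -> int) -> Prop) t t' z :
  in_Zspan S t -> in_Zspan S t' -> in_Zspan S (fun n => t n - z * t' n).
Proof.
move=> [k [g [c [Sg tE]]]] [k' [g' [c' [Sg' tE']]]].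
exists (k + k')%N, (cat_family g g'), (cat_family c (fun j => - (z * c' j))).
split=> [i|n]; first by rewrite /cat_family; case: split.
rewrite sum_cat_family tE tE' mulr_sumr -sumrN; congr (_ + _).
  by apply: eq_bigr => i _; rewrite cat_family_lshift.
by apply: eq_bigr => i _; rewrite cat_family_rshift mulNr mulrA.
Qed.

Lemma in_Zspan_trans (S : (nat -> int) -> Prop) (r : nat)
    (G : 'I_r -> nat -> int) :
  (forall t, S t -> exists c : 'I_r -> int,
     forall n, t n = \sum_(i < r) c i * G i n) ->
  forall t, in_Zspan S t -> exists c : 'I_r -> int,
     forall n, t n = \sum_(i < r) c i * G i n.
Proof.
move=> SG t [k [g [c [Sg tE]]]].
have /choice[d dE] i : exists c : 'I_r -> int,
  forall n, g i n = \sum_(i < r) c i * G i n by apply/SG/Sg.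
exists (fun j => \sum_(i < k) c i * d i j) => n.
under [RHS]eq_bigr => j _ do rewrite mulr_suml.
rewrite exchange_big tE; apply: eq_bigr => i _ /=.
by rewrite dE mulr_sumr; apply: eq_bigr => j _; rewrite mulrA.
Qed.

(* As for ideals of [int], the leading coefficients of the elements of [M] are
   the multiples of the least positive one, and what remains once they are
   cleared is spanned by one generator fewer. *)
Lemma submodule_finitely_generated (r : nat) (G : 'I_r -> nat -> int)
    (M : (nat -> int) -> Prop) :
  (forall t t' z, M t -> M t' -> M (fun n => t n - z * t' n)) ->
  (forall t, M t -> exists c : 'I_r -> int,
     forall n, t n = \sum_(i < r) c i * G i n) ->
  finitely_generated M.
Proof.
elim: r G M => [|r IHr] G M Msub MG.
  exists 0%N, (fun=> fun=> 0); split=> [[]//|t /MG[c tE]].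
  by exists c => n; rewrite tE !big_ord0.
(* The elements of [M] that do without the first generator; induction applies to them. *)
pose M' t := M t /\ exists c : 'I_r -> int,
  forall n, t n = \sum_(i < r) c i * G (lift ord0 i) n.
have [k [g [M'g gM']]] : finitely_generated M'.
  apply: (IHr (fun i => G (lift ord0 i))) => [t t' z|t []//].
  move=> [Mt [c tE]] [Mt' [c' tE']]; split; first exact: Msub.
  exists (fun i => c i - z * c' i) => n; rewrite tE tE' mulr_sumr -sumrB.
  by apply: eq_bigr => i _; ring.
(* [G] may satisfy relations, so leading coefficients are not unique; [P] collects all the positive
   ones. *)
pose P d := `[< (0 < d)%N /\ exists2 t, M t & exists c : 'I_r.+1 -> int,
  c ord0 = d%:Z /\ forall n, t n = \sum_(i < r.+1) c i * G i n >].
have lead0 t c : M t -> (forall n, t n = \sum_(i < r.+1) c i * G i n) ->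
    (forall d, P d -> (`|c ord0| < d)%N) -> M' t.
  move=> Mt tE cP; suff c0 : c ord0 = 0.
    split=> //; exists (fun i => c (lift ord0 i)) => n.
    by rewrite tE big_ord_recl c0 mul0r add0r.
  apply/eqP; rewrite -absz_eq0 -leqn0 leqNgt; apply/negP => c_gt0.
  suff /cP : P `|c ord0|%N by rewrite ltnn.
  apply/asboolP; split=> //; case: (lerP 0 (c ord0)) => c0.
    by exists t => //; exists c; split=> //; rewrite gez0_abs.
  (* This is [- t], built from the only closure property assumed of [M]. *)
  exists (fun n => (t n - 1 * t n) - 1 * t n).
    by apply: (Msub (fun n => t n - 1 * t n) t 1) => //; exact: Msub.
  exists (fun i => - c i); split; first by rewrite ltz0_abs.
  move=> n /=; rewrite mul1r subrr sub0r tE -sumrN.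
  by apply: eq_bigr => i _; rewrite mulNr.
case: (pselect (exists d, P d)) => [exP|noP]; last first.
  exists k, g; split=> [i|t Mt]; first by case: (M'g i).
  apply: gM'; have [c tE] := MG t Mt; apply: (lead0 t c) => // d Pd.
  by case: noP; exists d.
have [d Pd d_min] := ex_minnP exP.
have /asboolP[d_gt0 [t0 Mt0 [c0 [c00 t0E]]]] := Pd.
exists k.+1, (fun i => match unlift ord0 i with Some j => g j | None => t0 end).
split=> [i|t Mt]; first by case: unlift => // j; case: (M'g j).
have [c tE] := MG t Mt; set q := (c ord0 %/ d%:Z)%Z.
have [|c' c'E] := gM' (fun n => t n - q * t0 n).
  apply: (lead0 _ (fun i => c i - q * c0 i)); first exact: Msub.
    by move=> n; rewrite tE t0E mulr_sumr -sumrB; apply: eq_bigr => i _; ring.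
  move=> d' /d_min; apply: leq_trans; rewrite c00.
  have := divz_eq (c ord0) d; rewrite -/q.
  have dn0 : d%:Z != 0 by lia.
  have := modz_ge0 (c ord0) dn0; have := @ltz_pmod (c ord0) d%:Z ltac:(lia).
  lia.
exists (fun i => match unlift ord0 i with Some j => c' j | None => q end) => n.
rewrite big_ord_recl unlift_none.
under eq_bigr => i _ do rewrite liftK.
by rewrite -c'E; ring.
Qed.

(** Having more rows than columns, [C] has a nonzero rational vector in its left kernel; the product
    of the denominators makes it integral. *)
Lemma int_row_kernel (k r : nat) (C : 'M[int]_(k, r)) :
  (r < k)%N -> exists2 x : 'rV[int]_k, x != 0 & x *m C = 0.
Proof.
move=> lt_rk; pose f : {rmorphism int -> rat} := intr.
have /rowV0Pn[u /sub_kermxP uC u0] : kermx (map_mx f C) != 0.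
  by rewrite -mxrank_eq0 mxrank_ker; have := rank_leq_col (map_mx f C); lia.
pose d := \prod_j denq (u 0 j).
have d0 : d != 0 by apply/prodf_neq0 => j _; exact: denq_neq0.
have /choice[z zE] j : exists z : int, d%:~R * u 0 j = z%:~R :> rat.
  exists (numq (u 0 j) * \prod_(i | i != j) denq (u 0 i)).
  by rewrite /d (bigD1 j) //= !rmorphM /= numqE mulrAC [u 0 j * _]mulrC.
have zmap : map_mx f (\row_j z j) = d%:~R *: u.
  by apply/rowP => j; rewrite !mxE zE.
exists (\row_j z j).
  apply: contraNneq u0 => x0; move: zmap; rewrite x0 map_mx0 => /esym/eqP.
  by rewrite scaler_eq0 intr_eq0 (negPf d0).
have /rowP uC0 : map_mx f (\row_j z j *m C) = 0.
  by rewrite map_mxM /= zmap -scalemxAl uC scaler0.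
apply/rowP => j; apply: (@intr_inj rat); have := uC0 j.
by rewrite [LHS]mxE => ->; rewrite !mxE.
Qed.

Lemma Zfree_leq (k r : nat) (g : 'I_k -> nat -> int) (G : 'I_r -> nat -> int) :
  (forall i, exists c : 'I_r -> int,
     forall n, g i n = \sum_(j < r) c j * G j n) ->
  Zfree g -> (k <= r)%N.
Proof.
move=> /choice[c gE] gfree; rewrite leqNgt; apply/negP => lt_rk.
have [x x0 xC] := @int_row_kernel k r (\matrix_(i, j) c i j) lt_rk.
case/eqP: x0; apply/rowP => i; rewrite [RHS]mxE.
apply: (gfree (fun i => x 0 i)) => n.
under eq_bigr => j _ do rewrite gE mulr_sumr.
rewrite exchange_big big1 //= => j _.
have /rowP/(_ j) := xC; rewrite !mxE => xCj.
under eq_bigr => l _ do rewrite mulrA.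
rewrite -mulr_suml (_ : \sum_(l < k) _ = 0) ?mul0r // -[RHS]xCj.
by apply: eq_bigr => l _; rewrite mxE.
Qed.

(** [g] bounds the rank from below and [G] from above. [G] may lie outside the module, which is then
    finitely generated as a submodule of its span. *)
Lemma p_regular_rankP (p : nat) (s : nat -> int) (r : nat)
    (g G : 'I_r -> nat -> int) :
  (forall i, in_kernel p s (g i)) -> Zfree g ->
  (forall t, in_kernel p s t -> exists c : 'I_r -> int,
     forall n, t n = \sum_(i < r) c i * G i n) ->
  p_regular_rank p s r.
Proof.
move=> gs gfree /in_Zspan_trans sG; split.
  by apply: (submodule_finitely_generated r G) => // t t' z; exact: in_Zspan_subZ.
split=> [|k g' Mg' /Zfree_leq]; last by apply=> i; apply/sG/Mg'.
by exists g; split=> // i; apply/in_Zspan_gen.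
Qed.

(** * The rank of sequences with the valuation pattern *)

(** The valuation of [j] is less than [e], so adding a multiple of [p ^ e] preserves it. *)
Lemma logn_expMD p e n j : prime p -> (0 < j < p ^ e)%N ->
  logn p (p ^ e * n + j) = logn p j.
Proof.
move=> pr_p /andP[j_gt0 lt_j].
have lt_ve : (logn p j < e)%N.
  rewrite -(ltn_exp2l _ _ (prime_gt1 pr_p)); apply: leq_ltn_trans lt_j.
  by rewrite dvdn_leq // pfactor_dvdnn.
have s_gt0 : (0 < p ^ e * n + j)%N by rewrite addn_gt0 j_gt0 orbT.
have dvd_s f : (f <= e)%N -> (f <= logn p (p ^ e * n + j))%N = (f <= logn p j)%N.
  move=> fe; rewrite -!pfactor_dvdn // dvdn_addr //.
  by rewrite dvdn_mulr // dvdn_exp2l.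
have le_v : (logn p j <= logn p (p ^ e * n + j))%N by rewrite dvd_s // ltnW.
by apply/eqP; rewrite eqn_leq le_v andbT leqNgt dvd_s // ltnn.
Qed.

Lemma eqn_modMl_coprime d k m n :
  coprime d k -> (k * m == k * n %[mod d]) = (m == n %[mod d]).
Proof.
move=> co_dk; wlog le_nm : m n / (n <= m)%N => [IH|].
  by case: (leqP n m) => [|/ltnW] /IH // E; rewrite eq_sym E eq_sym.
by rewrite !eqn_mod_dvd ?leq_mul2l ?le_nm ?orbT // -mulnBr Gauss_dvdr.
Qed.

Section Pattern.
Variables (p t h0 h1 : nat).
Hypotheses (pr_p : prime p) (t_gt0 : (0 < t)%N) (co_tp : coprime t p).

(** The index is shifted as in [lucas_val]: the value at [n] models the valuation of [u_(n+1)]. *)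
Definition val_pattern (n : nat) : nat :=
  if (t %| n.+1)%N then
    if (p %| n.+1)%N then (logn p n.+1 + h1)%N else h0
  else 0%N.

Lemma val_pattern_periodic e i n n' : (i.+1 < p ^ e)%N -> n = n' %[mod t] ->
  val_pattern (p ^ e * n + i) = val_pattern (p ^ e * n' + i).
Proof.
move=> lt_i nn'; rewrite /val_pattern -!addnS !logn_expMD //.
have -> : (t %| p ^ e * n + i.+1)%N = (t %| p ^ e * n' + i.+1)%N.
  by rewrite /dvdn -modnDml -modnMmr nn' modnMmr modnDml.
have e_gt0 : (0 < e)%N by case: (e) lt_i; rewrite // expn0 ltnS.
have pE m : (p %| p ^ e * m + i.+1)%N = (p %| i.+1)%N.
  by rewrite dvdn_addr // dvdn_mulr // dvdn_exp.
by rewrite !pE.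
Qed.

Lemma val_pattern_last e n : (0 < e)%N ->
  val_pattern (p ^ e * n + (p ^ e).-1) =
  if (t %| n.+1)%N then (logn p n.+1 + e + h1)%N else 0%N.
Proof.
move=> e_gt0; rewrite /val_pattern -addnS prednK ?expn_gt0 ?prime_gt0 //.
rewrite -mulnSr Gauss_dvdr ?coprimeXr // dvdn_mulr ?dvdn_exp //.
by rewrite lognM // ?expn_gt0 ?prime_gt0 // pfactorK // (addnC e).
Qed.

Lemma exp_gt_self : (t < p ^ t)%N.
Proof. by apply: ltn_expl; exact: prime_gt1. Qed.

(** With [i] this residue, [p ^ t.+1 * n + i + 1] is [p] times a number congruent to [p ^ t (n - c)]
    modulo [t]: the pattern is nonzero exactly for [n] in the class of [c]. The factor [p] forces a
    positive value even if [h0 = 0]. *)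
Definition residue_witness (c : 'I_t) : nat := (p * (t - (p ^ t * c) %% t)).-1.

Lemma residue_witness_lt c : ((residue_witness c).+1 < p ^ t.+1)%N.
Proof.
have lt_r : ((p ^ t * c) %% t < t)%N by rewrite ltn_pmod.
rewrite /residue_witness prednK; last by rewrite muln_gt0 prime_gt0 ?subn_gt0.
rewrite expnS ltn_pmul2l ?prime_gt0 //.
by apply: leq_ltn_trans exp_gt_self; exact: leq_subr.
Qed.

Lemma residue_witness_eq0 c n :
  (val_pattern (p ^ t.+1 * n + residue_witness c) == 0%N) = (n %% t != c)%N.
Proof.
have lt_r : ((p ^ t * c) %% t < t)%N by rewrite ltn_pmod.
have j_gt0 : (0 < t - (p ^ t * c) %% t)%N by rewrite subn_gt0.
rewrite /val_pattern /residue_witness -addnS prednK ?muln_gt0 ?j_gt0 ?(prime_gt0 pr_p) //.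
rewrite expnS -mulnA -mulnDr (Gauss_dvdr _ co_tp) dvdn_mulr //.
have -> : (t %| p ^ t * n + (t - (p ^ t * c) %% t))%N = (n %% t == c)%N.
  transitivity (p ^ t * n + (t - (p ^ t * c) %% t) == 0 %[mod t])%N.
    by rewrite mod0n.
  rewrite -(eqn_modDr ((p ^ t * c) %% t)) add0n -addnA subnK ?(ltnW lt_r) //.
  by rewrite modnDr modn_mod eqn_modMl_coprime ?coprimeXr // (modn_small (ltn_ord c)).
case: ((n %% t)%N == c) => //=; rewrite lognM ?(prime_gt0 pr_p) ?addn_gt0 ?j_gt0 ?orbT //.
by rewrite logn_prime // eqxx.
Qed.

Lemma val_pattern_p n : val_pattern (p * n + p.-1) =
  if (t %| n.+1)%N then (logn p n.+1 + 1 + h1)%N else 0%N.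
Proof. by have := @val_pattern_last 1 n isT; rewrite expn1. Qed.

Lemma in_kernel_val_pattern_span (s w : nat -> int) :
  (forall n, s n = (val_pattern n)%:Z) -> in_kernel p s w ->
  (forall n, w n = s n) \/
  exists (al : nat -> int) (x : int),
     forall n, w n = al (n %% t)%N + x * s (p * n + p.-1)%N.
Proof.
move=> sE [[|e] [i [lt_i wE]]].
  left=> n; rewrite wE expn0 mul1n; congr s.
  by case: i lt_i {wE}; rewrite expn0 //= addn0.
right; move: lt_i; rewrite -(prednK (_ : 0 < p ^ e.+1))%N ?expn_gt0 ?prime_gt0 // ltnS.
rewrite leq_eqVlt => /orP[/eqP iE|lt_i].
  (* The exponent is [e.+1] here and 1 in [s (p * n + p.-1)], hence the difference [e]. *)
  exists (fun c => if (t %| c.+1)%N then e%:Z else 0), 1 => n.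
  rewrite wE !sE iE val_pattern_last // val_pattern_p.
  have -> : (t %| (n %% t).+1)%N = (t %| n.+1)%N.
    by rewrite /dvdn -addn1 modnDml addn1.
  by case: ifP => _; lia.
exists (fun c => s (p ^ e.+1 * c + i)%N), 0 => n.
rewrite wE mul0r addr0 !sE (@val_pattern_periodic _ _ n (n %% t)) ?modn_mod //.
by rewrite -(prednK (_ : 0 < p ^ e.+1))%N ?expn_gt0 ?prime_gt0.
Qed.

Definition residue_ind (c : 'I_t) (n : nat) : int := (n %% t == c)%N%:Z.

Lemma sum_residue_ind (al : nat -> int) n :
  al (n %% t)%N = \sum_(c < t) al c * residue_ind c n.
Proof.
rewrite (bigD1 (Ordinal (ltn_pmod n t_gt0))) //= /residue_ind eqxx mulr1.
rewrite big1 ?addr0 // => c; rewrite -val_eqE /= eq_sym => /negPf ->.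
by rewrite mulr0.
Qed.


(** At [n.+1 = t p ^ k] the periodic part has a value [K] independent of [k]. Subtracting [k = 1]
    from [k = 2] gives [x = - y], and then [k = 0] from [k = 1] gives [y (h1 - h0) = 0]. The last
    hypothesis reflects that [s] is left out of the family when [h0 = h1]. *)
Lemma val_pattern_free (s : nat -> int) (ga : 'I_t -> int) (x y : int) :
  (forall n, s n = (val_pattern n)%:Z) ->
  (forall n, \sum_(c < t) ga c * s (p ^ t.+1 * n + residue_witness c)%N
             + x * s (p * n + p.-1)%N + y * s n = 0) ->
  (h0 = h1 -> y = 0) -> [/\ forall c, ga c = 0, x = 0 & y = 0].
Proof.
move=> sE rel y0.
have periodic c n : s (p ^ t.+1 * n + residue_witness c)%N
    = s (p ^ t.+1 * (n %% t) + residue_witness c)%N.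
  by rewrite !sE (@val_pattern_periodic _ _ n (n %% t)) ?modn_mod // residue_witness_lt.
pose K := \sum_(c < t) ga c * s (p ^ t.+1 * t.-1 + residue_witness c)%N.
have relK k : K + x * (k%:Z + 1 + h1%:Z)
    + y * (if (0 < k)%N then k%:Z + h1%:Z else h0%:Z) = 0.
  pose n := (t * p ^ k).-1.
  have nE : n.+1 = (t * p ^ k)%N by rewrite prednK // muln_gt0 t_gt0 expn_gt0 prime_gt0.
  have nt : n = t.-1 %[mod t].
    apply/eqP; rewrite -(eqn_modDr 1) !addn1 nE prednK //.
    by rewrite modnMr modnn.
  have lognE : logn p n.+1 = k.
    rewrite nE lognM // ?expn_gt0 ?prime_gt0 // pfactorK //.
    by rewrite (logn_coprime (_ : coprime p t)) // coprime_sym.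
  have pn : (p %| n.+1)%N = (0 < k)%N.
    rewrite nE Gauss_dvdr ?[coprime p t]coprime_sym //.
    by case: (k) => [|f]; rewrite ?expnS ?dvdn_mulr // dvdn1; case: (p) pr_p => [|[]].
  have tn : (t %| n.+1)%N by rewrite nE dvdn_mulr.
  rewrite -(rel n) /K; congr (_ + _ * _ + _ * _).
  - by apply: eq_bigr => c _; rewrite [in RHS]periodic nt -periodic.
  - by rewrite sE val_pattern_p tn lognE; lia.
  by rewrite sE /val_pattern tn pn lognE; case: (0 < k)%N; lia.
have rel0 := relK 0%N; have rel1 := relK 1%N; have rel2 := relK 2%N.
rewrite /= in rel0 rel1 rel2.
have xy : x = - y.
  apply/eqP; rewrite -subr_eq0 opprK; apply/eqP; rewrite -[RHS](subrr (0 : int)).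
  by rewrite -{1}rel2 -rel1; ring.
have yh : y * (h1%:Z - h0%:Z) = 0.
  by rewrite -[RHS](subrr (0 : int)) -{1}rel1 -rel0 xy; ring.
have {}y0 : y = 0.
  have [/y0//|/eqP h01] := eqVneq h0 h1; apply/eqP; move/eqP: yh.
  by rewrite mulf_eq0 => /orP[//|]; lia.
rewrite y0 oppr0 in xy; split=> // c.
have := rel c; rewrite xy y0 !mul0r !addr0 (bigD1 c) //= big1 => [|i ic].
  rewrite addr0 => /eqP; rewrite mulf_eq0 => /orP[/eqP//|].
  rewrite sE -[_%:Z == 0]/(_ == 0%N) residue_witness_eq0.
  by rewrite modn_small // eqxx.
apply/eqP; rewrite mulf_eq0 sE -[_%:Z == 0]/(_ == 0%N) residue_witness_eq0.
by rewrite modn_small // (inj_eq val_inj) [c == i]eq_sym ic orbT.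
Qed.

(** The free family is made of a nonzero multiple of each residue indicator, of [V] itself, and of
    [s] when [h0 <> h1]. The multiples need not generate the indicators over the integers, so the
    spanning family uses the indicators themselves. *)
Lemma val_pattern_rank (s : nat -> int) :
  (forall n, s n = (val_pattern n)%:Z) ->
  p_regular_rank p s (t + (h0 != h1).+1).
Proof.
move=> sE.
pose g c n := s (p ^ t.+1 * n + residue_witness c)%N.
pose V n := s (p * n + p.-1)%N.
pose H (j : 'I_(h0 != h1).+1) := if j == ord0 then V else s.
(* [y] is the coefficient of [s], set to 0 when [H] consists of [V] alone. *)
have sumH (c : 'I_(h0 != h1).+1 -> int) : exists2 y, (h0 = h1 -> y = 0) &
    (forall n, \sum_j c j * H j n = c ord0 * V n + y * s n)
    /\ (y = 0 -> c ord0 = 0 -> forall j, c j = 0).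
  rewrite /H; case: eqVneq c => /= [_|h01] c.
    exists 0 => //; split=> [n|_ c0 j]; first by rewrite big_ord1 mul0r addr0.
    by rewrite (ord1 j).
  exists (c (lift ord0 ord0)) => [E|]; first by rewrite E eqxx in h01.
  split=> [n|c1 c0 j].
    by rewrite !big_ord_recl big_ord0 addr0.
  by case: (unliftP ord0 j) => [i ->|->//]; rewrite (ord1 i).
apply: (@p_regular_rankP _ _ _ (cat_family g H) (cat_family residue_ind H)).
- move=> i; rewrite /cat_family; case: split => [c|j].
    by exists t.+1, (residue_witness c); split=> //; apply: ltnW (residue_witness_lt c).
  rewrite /H; case: ifP => _.
    by exists 1%N, p.-1; rewrite expn1 prednK ?prime_gt0.
  by exists 0%N, 0%N; split=> // n; rewrite expn0 mul1n addn0.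
- move=> c rel; have [y y0 [sumE c0]] := sumH (fun j => c (rshift t j)).
  have [|ga0 x0 {}y0] := @val_pattern_free s (fun j => c (lshift _ j))
      (c (rshift t ord0)) y sE _ y0.
    by move=> n; rewrite -addrA -sumE -[RHS](rel n) sum_cat_family.
  move=> i; case: (split_ordP i) => j ->; first exact: ga0.
  exact: c0.
have combH x y : (h0 = h1 -> y = 0) -> exists c : 'I_(h0 != h1).+1 -> int,
    forall n, \sum_j c j * H j n = x * V n + y * s n.
  move=> y0; exists (fun j => if j == ord0 then x else y) => n.
  rewrite /H; case: eqVneq y0 => /= [_ ->//|_ _]; first by rewrite big_ord1 mul0r addr0.
  by rewrite !big_ord_recl big_ord0 addr0.
have comb al x y : (h0 = h1 -> y = 0) -> exists c : 'I_(t + (h0 != h1).+1) -> int,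
    forall n, al (n %% t)%N + x * V n + y * s n
      = \sum_i c i * cat_family residue_ind H i n.
  move=> /(combH x)[d dE]; exists (cat_family (fun c : 'I_t => al c) d) => n.
  rewrite sum_cat_family -addrA -dE sum_residue_ind.
  congr (_ + _); apply: eq_bigr => i _; first by rewrite cat_family_lshift.
  by rewrite cat_family_rshift.
move=> w /(in_kernel_val_pattern_span _ _ sE)[wE|[al [x wE]]].
  case: (pselect (h0 = h1)) => h01; last first.
    have [c cE] := comb (fun=> 0) 0 1 (fun E => False_ind _ (h01 E)).
    by exists c => n; rewrite -cE wE mul0r mul1r !add0r.
  (* For [h0 = h1], [s] is [V] minus the indicator of [t %| n.+1]. *)
  have [c cE] := comb (fun c => if (t %| c.+1)%N then -1 else 0) 1 0 (fun=> erefl).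
  exists c => n; rewrite -cE wE /V !sE val_pattern_p mul0r mul1r addr0 /val_pattern.
  have -> : (t %| (n %% t).+1)%N = (t %| n.+1)%N.
    by rewrite /dvdn -addn1 modnDml addn1.
  case: ifP => // _; case: ifP => [_|pn]; first by lia.
  by rewrite lognE pn !andbF; lia.
have [c cE] := comb al x 0 (fun=> erefl).
by exists c => n; rewrite -cE wE mul0r addr0.
Qed.
End Pattern.

(** * Valuations of Lucas numbers *)

Lemma lucasS a b n :
  lucas a b n.+2 = a * lucas a b n.+1 + b * lucas a b n.
Proof. by []. Qed.

(** The factor [u_(m+1) - a u_m] is [b u_(m-1)], in a form that makes sense for [m = 0]. *)
Lemma lucasD a b m n : lucas a b (m + n) =
  lucas a b m * lucas a b n.+1 + (lucas a b m.+1 - a * lucas a b m) * lucas a b n.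
Proof.
suff [//] : lucas a b (m + n) = lucas a b m * lucas a b n.+1
      + (lucas a b m.+1 - a * lucas a b m) * lucas a b n
  /\ lucas a b (m + n.+1) = lucas a b m * lucas a b n.+2
      + (lucas a b m.+1 - a * lucas a b m) * lucas a b n.+1.
elim: n => [|n [IH1 IH2]].
  by rewrite addn0 addn1 lucasS /=; split; ring.
by split=> //; rewrite !addnS lucasS -addnS IH2 IH1 !lucasS; ring.
Qed.

Lemma lucas_dvd_mul a b m k : (lucas a b m %| lucas a b (m * k))%Z.
Proof.
elim: k => [|k IHk]; first by rewrite muln0 dvdz0.
rewrite mulnS lucasD; apply: rpredD; first by rewrite dvdz_mulr.
by rewrite dvdz_mull.
Qed.

(** Binet's formula, multiplied by [x - y] to avoid a division, turns [u_n = 0] into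
    [x ^ n = y ^ n], against nondegeneracy. *)
Lemma lucas_neq0 a b n :
  lucas_nondegenerate a b -> (0 < n)%N -> lucas a b n != 0.
Proof.
move=> [b0 nd] n_gt0.
pose A : algC := a%:~R; pose B : algC := b%:~R.
pose d := sqrtC (A ^+ 2 + 4 * B).
have dd : d * d = A ^+ 2 + 4 * B by rewrite -expr2 sqrtCK.
pose x := (A + d) / 2; pose y := (A - d) / 2.
have xyD : x + y = A by rewrite /x /y; field.
have xyM : x * y = - B.
  have -> : x * y = (A ^+ 2 - d * d) / 4 by rewrite /x /y; field.
  by rewrite dd; field.
have poly : 'X^2 - A%:P * 'X - B%:P = ('X - x%:P) * ('X - y%:P) :> {poly algC}.
  have -> : B%:P = - (x%:P * y%:P) :> {poly algC} by rewrite -polyCM xyM polyCN opprK.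
  by rewrite -xyD polyCD; ring.
have y0 : y != 0.
  apply/eqP => y0; move: xyM; rewrite y0 mulr0 => /eqP.
  by rewrite eq_sym oppr_eq0 intr_eq0; apply/negP/eqP.
have lucasE m : (lucas a b m)%:~R * (x - y) = x ^+ m - y ^+ m.
  suff [] : (lucas a b m)%:~R * (x - y) = x ^+ m - y ^+ m /\
    (lucas a b m.+1)%:~R * (x - y) = x ^+ m.+1 - y ^+ m.+1 by [].
  elim: m => [|m [IH1 IH2]]; first by rewrite /= mul0r mul1r !expr0 !expr1 subrr.
  split=> //; rewrite lucasS rmorphD !rmorphM /= -/A -/B mulrDl -!mulrA IH1 IH2.
  have -> : B = - (x * y) by rewrite xyM opprK.
  by rewrite -xyD !exprS; ring.
apply/eqP => un0; apply: (nd x y poly n n_gt0).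
move: (lucasE n); rewrite un0 mul0r => /esym/eqP; rewrite subr_eq0 => /eqP xy.
by rewrite expr_div_n xy divff // expf_neq0.
Qed.

Lemma prime_dvdzM (p : nat) (x y : int) : prime p ->
  (p %| x * y)%Z = (p %| x)%Z || (p %| y)%Z.
Proof. by move=> pr_p; rewrite !dvdzE abszM Euclid_dvdM. Qed.

Lemma prime_dvdzX (p n : nat) (x : int) : prime p ->
  (p %| x)%Z = false -> (p %| x ^+ n)%Z = false.
Proof.
move=> pr_p px; elim: n => [|n IHn]; last by rewrite exprS prime_dvdzM ?px.
by rewrite expr0 dvdzE /= dvdn1; case: p pr_p {px} => [|[]].
Qed.

Lemma padic_valM p (x y : int) : x != 0 -> y != 0 ->
  padic_val p (x * y) = (padic_val p x + padic_val p y)%N.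
Proof. by move=> x0 y0; rewrite /padic_val abszM lognM // absz_gt0. Qed.

Lemma padic_val_eq0 (p : nat) (x : int) : (p %| x)%Z = false -> padic_val p x = 0%N.
Proof. by rewrite dvdzE /= => px; rewrite /padic_val lognE px !andbF. Qed.

Lemma padic_val_pM (p : nat) (y : int) : prime p -> (p %| y)%Z = false ->
  padic_val p (p%:Z * y) = 1%N.
Proof.
move=> pr_p py; rewrite padic_valM ?(padic_val_eq0 p y) //.
- by rewrite /padic_val /= logn_prime ?eqxx.
- by have := prime_gt0 pr_p; lia.
- by apply: contraFneq py => ->; rewrite dvdz0.
Qed.

(** * Valuations along the multiples of an index *)

Section Valuation.
Variables (a b : int) (p : nat).
Hypotheses (pr_p : prime p) (pb : (p %| b)%Z = false).
Hypothesis u_neq0 : forall n, (0 < n)%N -> lucas a b n != 0.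
Local Notation u := (lucas a b).
Local Notation nu := (padic_val p).

Lemma lucas_dvd_succ n : (p %| u n)%Z -> (p %| u n.+1)%Z = false.
Proof.
elim: n => [|n IHn] pn.
  by rewrite dvdzE /= dvdn1; case: p pr_p => [|[]].
apply/negP; rewrite lucasS rpredDl; last by rewrite dvdz_mull.
by rewrite prime_dvdzM // pb /= => /IHn; rewrite pn.
Qed.

Lemma lucas_dvd_cofactor n :
  (p %| u n)%Z -> (p %| u n.+1 - a * u n)%Z = false.
Proof.
move=> pn; rewrite rpredDr ?lucas_dvd_succ //.
by rewrite rpredN dvdz_mull.
Qed.

Lemma lucas_dvdD m n : (p %| u m)%Z -> (p %| u (m + n))%Z = (p %| u n)%Z.
Proof.
move=> pm; rewrite lucasD rpredDl; last by rewrite dvdz_mulr.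
by rewrite prime_dvdzM // lucas_dvd_cofactor.
Qed.

(** Law of apparition: shifting the index by [t] multiplies [u] modulo [p] by a unit, so only the
    remainder modulo [t] matters. *)
Lemma lucas_dvd_apparition t n : is_apparition_rank a b p t ->
  (p %| u n)%Z = (t %| n)%N.
Proof.
move=> [t_gt0 pt t_min].
have pmul k m : (p %| u (k * t + m))%Z = (p %| u m)%Z.
  by elim: k => [//|k IHk]; rewrite mulSn -addnA lucas_dvdD.
rewrite {1}(divn_eq n t) pmul /dvdn.
case: posnP => [->|r_gt0]; first by rewrite dvdz0.
apply/negP => /(t_min _ r_gt0); by rewrite leqNgt ltn_mod t_gt0.
Qed.

(* Writing [A ^ m = u_m A + c] for the companion matrix [A], these are the
   coefficients of [A ^ (m k) = (u_m A + c) ^ k] modulo [u_m ^ 3] and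
   [u_m ^ 2]; the factor [c ^ 2] avoids negative exponents. *)
Lemma lucas_mul_expansion m k (t := u m) (c := u m.+1 - a * u m) :
  exists q r : int,
    c ^+ 2 * u (m * k) = k%:Z * t * c ^+ k.+1 + 'C(k, 2)%:Z * t ^+ 2 * a * c ^+ k
                         + t ^+ 3 * q
    /\ u (m * k).+1 - a * u (m * k) = c ^+ k + t ^+ 2 * r.
Proof.
elim: k => [|k [q [r [IHu IHw]]]].
  by exists 0, 0; rewrite muln0 bin0n /=; split; ring.
set U := u (m * k) in IHu IHw; set W := _ - _ in IHw.
have EU : u (m * k.+1) = (a * t + c) * U + t * W.
  by rewrite mulnS addnC lucasD /W /U /c /t; ring.
have EW : u (m * k.+1).+1 - a * u (m * k.+1) = b * t * U + c * W.
  rewrite EU mulnS addnC -addnS lucasD lucasS /W /U /c /t -/U; ring.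
have [z Uz] : exists z, U = t * z.
  by have /dvdzP[z Ez] := lucas_dvd_mul a b m k; exists z; rewrite /U Ez mulrC.
exists (a * ('C(k, 2)%:Z * a * c ^+ k) + a * t * q + c * q + c ^+ 2 * r),
  (b * z + c * r).
split; last by rewrite EW IHw Uz [c ^+ k.+1]exprS; ring.
have -> : 'C(k.+1, 2)%:Z = 'C(k, 2)%:Z + k%:Z by rewrite binS bin1 PoszD.
have -> : c ^+ 2 * u (m * k.+1) = (a * t + c) * (c ^+ 2 * U) + c ^+ 2 * t * W.
  by rewrite EU; ring.
have -> : k.+1%:Z = k%:Z + 1 by rewrite intS addrC.
by rewrite IHu IHw [c ^+ k.+2]exprS [c ^+ k.+1]exprS; ring.
Qed.

(** The expansion is divided by [u_m]; [c] is prime to [p], so [c ^ 2] does not affect the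
    valuation. *)
Lemma lucas_val_mul_expansion m k : (0 < m)%N -> (0 < k)%N -> (p %| u m)%Z ->
  exists c q : int, (p %| c)%Z = false /\
    nu (u (m * k)) =
    (nu (u m) + nu (k%:Z * c ^+ k.+1 + 'C(k, 2)%:Z * u m * a * c ^+ k
                    + u m ^+ 2 * q)%R)%N.
Proof.
move=> m0 k0 pm; have [q [r [E _]]] := lucas_mul_expansion m k.
have pc := lucas_dvd_cofactor m pm; set c := _ - _ in pc E.
exists c, q; split=> //.
have c0 : c ^+ 2 != 0 by rewrite expf_neq0 //; apply: contraFneq pc => ->; rewrite dvdz0.
have mk0 : u (m * k) != 0 by rewrite u_neq0 // muln_gt0 m0.
have {}E : c ^+ 2 * u (m * k) = u m *
   (k%:Z * c ^+ k.+1 + 'C(k, 2)%:Z * u m * a * c ^+ k + u m ^+ 2 * q) by rewrite E; ring.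
rewrite -padic_valM -?E ?u_neq0 //; last first.
  by move: (mulf_neq0 c0 mk0); rewrite E mulf_eq0 negb_or => /andP[].
by rewrite padic_valM // (padic_val_eq0 p (c ^+ 2)) // prime_dvdzX.
Qed.

Lemma lucas_val_mul_coprime m k : (0 < m)%N -> (p %| u m)%Z -> ~~ (p %| k)%N ->
  nu (u (m * k)) = nu (u m).
Proof.
move=> m0 pm pk; have k0 : (0 < k)%N by case: k pk => //; rewrite dvdn0.
have [c [q [pc ->]]] := lucas_val_mul_expansion m k m0 k0 pm.
rewrite [X in (_ + X)%N]padic_val_eq0 ?addn0 //.
rewrite rpredDr; last by rewrite dvdz_mulr // expr2 dvdz_mulr.
rewrite rpredDr; last by rewrite -mulrA -mulrA dvdz_mull // dvdz_mulr.
by rewrite prime_dvdzM // prime_dvdzX // dvdzE /= (negPf pk).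
Qed.

(** In the expansion the first term has valuation 1 and the others vanish modulo [p ^ 2]. For the
    binomial term and odd [p], this is because [p] divides both ['C(p, 2)] and [u_m]; for [p = 2]
    the binomial is 1 and [4 %| a * u_m] takes over. *)
Lemma lucas_val_mul_prime m : (0 < m)%N -> (p %| u m)%Z ->
  (2 < p)%N \/ (4 %| a * u m)%Z -> nu (u (m * p)) = (nu (u m)).+1.
Proof.
move=> m0 pm cond; have p0 := prime_gt0 pr_p.
have [c [q [pc ->]]] := lucas_val_mul_expansion m p m0 p0 pm.
have /dvdzP[t' Et] := pm.
suff [z Ez] : exists z, 'C(p, 2)%:Z * u m * a = p%:Z * (p%:Z * z).
  rewrite Ez {}Et.
  have -> : p%:Z * c ^+ p.+1 + p%:Z * (p%:Z * z) * c ^+ p + (t' * p) ^+ 2 * q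
     = p%:Z * (c ^+ p.+1 + p%:Z * (z * c ^+ p + t' ^+ 2 * q)) by ring.
  rewrite padic_val_pM ?addn1 // rpredDr ?prime_dvdzX //.
  by rewrite dvdz_mulr // dvdzz.
have [p2|p2] := eqVneq p 2.
  case: cond => [|/dvdzP[w Ew]]; first by rewrite p2.
  exists w; rewrite p2 binn -mulrA [u m * a]mulrC Ew; ring.
have p_gt2 : (2 < p)%N by rewrite ltn_neqAle eq_sym p2 prime_gt1.
have /dvdnP[w Ew] : (p %| 'C(p, 2))%N by apply: prime_dvd_bin.
by exists (w%:Z * t' * a); rewrite Ew Et PoszM; ring.
Qed.

(** The condition passes from [m] to [m p ^ f] since [u_m] divides [u_(m p ^ f)], so each factor [p]
    of [k] adds one. *)
Lemma lucas_val_mul m k : (0 < m)%N -> (0 < k)%N -> (p %| u m)%Z ->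
  (2 < p)%N \/ (4 %| a * u m)%Z ->
  nu (u (m * k)) = (nu (u m) + logn p k)%N.
Proof.
move=> m0 k0 pm cond.
have [j pj kE] := pfactor_coprime pr_p k0; rewrite {1}kE.
set e := logn p k.
have j0 : (0 < j)%N.
  by case: (j) pj => [|//]; rewrite /coprime gcdn0; case: (p) pr_p => [|[]].
rewrite [(j * _)%N]mulnC mulnA.
have dvd_me : (u m %| u (m * p ^ e))%Z := lucas_dvd_mul _ _ _ _.
rewrite lucas_val_mul_coprime //; last first.
- by rewrite -prime_coprime // coprime_sym.
- exact: dvdz_trans dvd_me.
- by rewrite muln_gt0 m0 expn_gt0 prime_gt0.
elim: (e) => [|f IHf]; first by rewrite muln1 addn0.
have dvd_mf : (u m %| u (m * p ^ f))%Z := lucas_dvd_mul _ _ _ _.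
rewrite expnSr mulnA lucas_val_mul_prime ?IHf ?addnS //.
- by rewrite muln_gt0 m0 expn_gt0 prime_gt0.
- exact: dvdz_trans dvd_mf.
case: cond => [|d4]; [by left | right].
by apply: dvdz_trans d4 _; apply: dvdz_mul (dvdzz a) dvd_mf.
Qed.

End Valuation.

(* Half the expansion of [((a + sqrt D) ^ n.+1 - (a - sqrt D) ^ n.+1) / sqrt D]
   modulo [D ^ 2]; the factor [a ^ 2] avoids negative exponents. *)
Lemma lucas_disc_expansion a b n (D := lucas_disc a b) : exists q,
  a ^+ 2 * (2 ^+ n * lucas a b n.+1) =
  n.+1%:Z * a ^+ n.+2 + 'C(n.+1, 3)%:Z * a ^+ n * D + D ^+ 2 * q.
Proof.
suff [] : (exists q, a ^+ 2 * (2 ^+ n * lucas a b n.+1) =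
    n.+1%:Z * a ^+ n.+2 + 'C(n.+1, 3)%:Z * a ^+ n * D + D ^+ 2 * q) /\
  (exists q, a ^+ 2 * (2 ^+ n.+1 * lucas a b n.+2) =
    n.+2%:Z * a ^+ n.+3 + 'C(n.+2, 3)%:Z * a ^+ n.+1 * D + D ^+ 2 * q) by [].
elim: n => [|n [[q IH1] [r IH2]]].
  by split; exists 0; rewrite bin_small //= ?mulr0 ?addr0; ring.
split; first by exists r.
exists ('C(n.+1, 3)%:Z * a ^+ n + q * (D - a ^+ 2) + 2 * a * r).
(* The recurrence, rewritten with [4 b = D - a ^ 2]. *)
have -> : a ^+ 2 * (2 ^+ n.+2 * lucas a b n.+3) =
    2 * a * (a ^+ 2 * (2 ^+ n.+1 * lucas a b n.+2))
    + (D - a ^+ 2) * (a ^+ 2 * (2 ^+ n * lucas a b n.+1)).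
  rewrite [lucas a b n.+3]lucasS /D /lucas_disc.
  by rewrite [2 ^+ n.+2]exprS [2 ^+ n.+1]exprS; ring.
rewrite IH1 IH2.
have -> : 'C(n.+3, 3)%:Z = 'C(n.+1, 3)%:Z + 'C(n.+1, 2)%:Z *+ 2 + n.+1%:Z.
  by rewrite [in LHS]binS ![in 'C(n.+2, _)]binS bin1; lia.
have -> : 'C(n.+2, 3)%:Z = 'C(n.+1, 3)%:Z + 'C(n.+1, 2)%:Z by rewrite binS; lia.
have -> : n.+3%:Z = n.+1%:Z + 2 by lia.
have -> : n.+2%:Z = n.+1%:Z + 1 by lia.
by rewrite [a ^+ n.+4]exprS [a ^+ n.+3]exprS [a ^+ n.+2]exprS [a ^+ n.+1]exprS; ring.
Qed.

(** * Primes dividing the discriminant *)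

Section Discriminant.
Variables (a b : int) (p : nat).
Hypotheses (pr_p : prime p) (pb : (p %| b)%Z = false).
Local Notation u := (lucas a b).

Lemma odd_prime_dvdz2 : (2 < p)%N -> (p %| 2)%Z = false.
Proof. by move=> p_gt2; apply/negbTE; rewrite dvdzE /= gtnNdvd. Qed.

Lemma lucas_disc_dvd_coef : (p %| lucas_disc a b)%Z -> (p %| a)%Z = (p == 2)%N.
Proof.
move=> pD; have [p2|p2] := eqVneq p 2.
  suff : (p %| a ^+ 2)%Z by rewrite expr2 prime_dvdzM // orbb.
  have -> : a ^+ 2 = lucas_disc a b - 4 * b by rewrite /lucas_disc; ring.
  by rewrite rpredB // p2 (_ : 4 = 2%:Z * 2) // -mulrA dvdz_mulr.
apply/negP => pa; have p_gt2 : (2 < p)%N by rewrite ltn_neqAle eq_sym p2 prime_gt1.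
move: pD; rewrite /lucas_disc rpredDl; last by rewrite expr2 dvdz_mulr.
by rewrite (_ : 4 = 2 * 2) // !prime_dvdzM // odd_prime_dvdz2 // pb.
Qed.

(** Modulo an odd [p], [2 ^ n u_(n+1)] is [(n + 1) a ^ n] with [a] invertible, so divisibility of
    [u_(n+1)] is that of [n + 1]. For [p = 2], [u_2 = a] is even. *)
Lemma lucas_disc_apparition : (p %| lucas_disc a b)%Z -> is_apparition_rank a b p p.
Proof.
move=> pD; have pa := lucas_disc_dvd_coef pD.
have [p2|p2] := eqVneq p 2.
  rewrite p2 in pa *; split=> // [|[|[|n]] //]; first by rewrite /= mulr1 mulr0 addr0.
have p_gt2 : (2 < p)%N by rewrite ltn_neqAle eq_sym p2 prime_gt1.
rewrite (negPf p2) in pa.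
have pu n : (p %| u n.+1)%Z = (p %| n.+1)%N.
  have [q E] := lucas_disc_expansion a b n.
  have -> : (p %| u n.+1)%Z = (p %| a ^+ 2 * (2 ^+ n * u n.+1))%Z.
    have p2n : (p %| 2 ^+ n)%Z = false by rewrite prime_dvdzX // ?odd_prime_dvdz2.
    by rewrite !prime_dvdzM // ?p2n ?pa.
  rewrite E rpredDr; last by rewrite dvdz_mulr // expr2 dvdz_mulr.
  rewrite rpredDr; last by rewrite dvdz_mull.
  by rewrite prime_dvdzM // prime_dvdzX // orbF.
split; first exact: prime_gt0.
  by have := pu p.-1; rewrite prednK ?prime_gt0 // dvdnn.
by case=> // n _; rewrite pu => /dvdn_leq; apply.
Qed.

(** As [p] divides ['C(p, 3)] from 5 on, all terms of the expansion but [p a ^ (p+1)] vanish modulo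
    [p ^ 2]. *)
Lemma lucas_disc_val_prime : (5 <= p)%N -> (p %| lucas_disc a b)%Z ->
  padic_val p (u p) = 1%N.
Proof.
move=> p_ge5 pD; have p_gt2 : (2 < p)%N by apply: leq_trans p_ge5.
have pa : (p %| a)%Z = false by rewrite lucas_disc_dvd_coef //; lia.
have [q] := lucas_disc_expansion a b p.-1.
rewrite prednK ?prime_gt0 //; set x := a ^+ 2 * _ => E.
have /dvdzP[d dE] := pD.
have /dvdnP[w wE] : (p %| 'C(p, 3))%N by apply: prime_dvd_bin => //; lia.
have {}E : x = p%:Z * (a ^+ p.+1 + p%:Z * (w%:Z * a ^+ p.-1 * d + d ^+ 2 * q)).
  by rewrite E wE dE PoszM; ring.
have x1 : padic_val p x = 1%N.
  by rewrite E padic_val_pM // rpredDr ?prime_dvdzX // dvdz_mulr.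
(* [padic_val] is 0 at 0, so a valuation of 1 excludes [u p = 0]. *)
have u0 : u p != 0.
  by apply: contra_eq_neq x1 => u0; rewrite /x u0 !mulr0 /padic_val logn0.
have a0 : a != 0 by apply: contraFneq pa => ->; rewrite dvdz0.
move: x1; rewrite /x !padic_valM ?mulf_neq0 ?expf_neq0 //.
have p2 : (p %| 2 ^+ p.-1)%Z = false by rewrite prime_dvdzX ?odd_prime_dvdz2.
by rewrite (padic_val_eq0 _ _ p2) !(padic_val_eq0 _ _ pa).
Qed.

End Discriminant.

(** * The companion matrix modulo [p] and the rank of apparition *)

Section Companion.
Variables (a b : int) (p : nat).
Hypotheses (pr_p : prime p) (pb : (p %| b)%Z = false).
Local Notation u := (lucas a b).

Definition companion : 'M['F_p]_2 :=
  \matrix_(i, j) if i == 0 then (if j == 0 then a%:~R else b%:~R) else (j == 0)%:R.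
Local Notation A := companion.

Lemma companion_sqr : A * A = a%:~R *: A + b%:~R%:A.
Proof.
apply/matrixP => -[[|[|//]] ?] [[|[|//]] ?];
  by rewrite !mxE !big_ord_recl big_ord0 !mxE -!val_eqE /=; ring.
Qed.

Lemma companionX n : A ^+ n = (u n)%:~R *: A + (u n.+1 - a * u n)%:~R%:A.
Proof.
elim: n => [|n IHn].
  by rewrite expr0 /= scale0r add0r mulr0 subr0 scale1r.
rewrite exprSr IHn mulrDl -scalerAl companion_sqr scalerDr addrAC.
rewrite -scalerAl mul1r !scalerA -!scalerDl -rmorphM -rmorphD.
by rewrite -rmorphM lucasS /=; congr (_%:~R *: _ + _%:~R *: _); ring.
Qed.

(** Entry (1, 0) reads off the coefficient of [A], which for [A ^ n] is [u_n]. *)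
Lemma companion10 (x y : 'F_p) : (x *: A + y%:A) 1 0 = x.
Proof. by rewrite !mxE /= mulr1 mulr0 addr0. Qed.

Lemma lucas_modp_eq0 n : (p %| u n)%Z = ((u n)%:~R == 0 :> 'F_p).
Proof. by rewrite (dvdz_pcharf (pchar_Fp pr_p)). Qed.

(** [A] is invertible as [p] does not divide [b], and its order [n] in the finite unit group gives
    [A ^ n = 1], whose entry (1, 0) is 0. *)
Lemma exists_lucas_dvd : exists2 n, (0 < n)%N & (p %| u n)%Z.
Proof.
have b0 : b%:~R != 0 :> 'F_p by rewrite -(dvdz_pcharf (pchar_Fp pr_p)) pb.
have uA : A \is a GRing.unit.
  have AV : A * ((b%:~R)^-1 *: (A - a%:~R%:A)) = 1.
    rewrite -scalerAr mulrBr companion_sqr -scalerAr mulr1 addrAC subrr add0r.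
    by rewrite scalerA mulVf // scale1r.
  by case: (mulmx1_unit AV).
pose g : {unit 'M['F_p]_2} := FinRing.Unit uA.
exists #[g]%g; first exact: order_gt0.
have := FinRing.val_unitX #[g]%g g; rewrite expg_order /= companionX.
by move/matrixP/(_ 1 0); rewrite companion10 lucas_modp_eq0 => <-; rewrite mxE.
Qed.

Lemma exists_apparition_rank : exists t, is_apparition_rank a b p t.
Proof.
have exP : exists n, (0 < n)%N && (p %| u n)%Z.
  by have [n n0 pn] := exists_lucas_dvd; exists n; rewrite n0.
have [t /andP[t0 pt] t_min] := ex_minnP exP.
by exists t; split=> // n n0 pn; apply: t_min; rewrite n0.
Qed.

Lemma pchar_matrix : p \in [pchar 'M['F_p]_2].
Proof. by rewrite pchar_lalg pchar_Fp. Qed.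

Lemma frobenius_linear (x y : 'F_p) (M : 'M['F_p]_2) :
  (x *: M + y%:A) ^+ p = x ^+ p *: M ^+ p + (y ^+ p)%:A.
Proof.
have := @pFrobenius_autD_comm _ p pchar_matrix (x *: M) y%:A.
rewrite !pFrobenius_autE => -> //.
  by rewrite !exprZn expr1n.
by rewrite /GRing.comm -!scalerAl -!scalerAr mulr1 mul1r !scalerA mulrC.
Qed.

(** Raising [A ^ m = u_m A + c] to the power [p] is additive, and only [A ^ p] contributes to the
    coefficient of [A]. *)
Lemma lucas_mul_prime_modp m :
  (u (m * p))%:~R = (u m)%:~R ^+ p * (u p)%:~R :> 'F_p.
Proof.
have := exprM A m p; rewrite companionX [A ^+ m]companionX frobenius_linear.
rewrite [A ^+ p]companionX scalerDr !scalerA -addrA -scalerDl => /matrixP/(_ 1 0).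
by rewrite !companion10.
Qed.

(** For odd [p], the matrix [D = 2 A - a] squares to the discriminant, so [D ^ p] is [D] times its
    power of exponent [p./2]. Frobenius expands [D ^ p] as [2 ^ p A ^ p + (- a) ^ p]; comparing
    coefficients of [A] shows that [2 ^ p u_p] is nonzero. *)
Lemma lucas_prime_ndvd : ~~ (p %| lucas_disc a b)%Z -> ~~ (p %| u p)%Z.
Proof.
move=> pD; have [p2|p2] := eqVneq p 2.
  rewrite p2 /= mulr1 mulr0 addr0 in pD *; apply: contra pD => pa.
  by rewrite /lucas_disc rpredD // ?expr2 ?dvdz_mulr.
have p_gt2 : (2 < p)%N by rewrite ltn_neqAle eq_sym p2 prime_gt1.
have two0 : (2 : 'F_p) != 0.
  by have := dvdz_pcharf (pchar_Fp pr_p) 2; rewrite odd_prime_dvdz2 // => <-.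
pose D : 'M['F_p]_2 := 2 *: A + (- a%:~R)%:A.
have DD : D * D = (lucas_disc a b)%:~R%:A.
  rewrite /D mulrDl !mulrDr -!scalerAl -!scalerAr !mul1r !mulr1 companion_sqr.
  apply/matrixP => i j; rewrite !mxE /lucas_disc rmorphD rmorphXn rmorphM /=; ring.
have Dp : D ^+ p = (lucas_disc a b)%:~R ^+ p./2 *: D.
  have odd_p : odd p by case: (even_prime pr_p) p2 => [->|].
  transitivity (D ^+ (p./2).*2.+1).
    by congr (D ^+ _); rewrite -[LHS]odd_double_half odd_p.
  by rewrite exprS -mul2n exprM expr2 DD exprZn expr1n -scalerAr mulr1.
move: Dp; rewrite /D frobenius_linear companionX !scalerDr !scalerA -addrA -scalerDl.
move/matrixP/(_ 1 0); rewrite !companion10 lucas_modp_eq0 => E.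
apply/negP => /eqP up0; move/eqP: E; rewrite up0 mulr0 eq_sym mulf_eq0 (negPf two0) orbF.
by rewrite expf_eq0 -(dvdz_pcharf (pchar_Fp pr_p)) (negPf pD) andbF.
Qed.

(** If [t = m p], then [u_t = u_m ^ p u_p] modulo [p] with [u_p] a unit, so [p] divides [u_m] with
    [m < t]. *)
Lemma apparition_coprime t : is_apparition_rank a b p t ->
  ~~ (p %| lucas_disc a b)%Z -> coprime t p.
Proof.
move=> [t0 pt t_min] /lucas_prime_ndvd pup.
rewrite coprime_sym prime_coprime //; apply/negP => /dvdnP[m tE].
have m0 : (0 < m)%N by move: t0; rewrite tE muln_gt0 => /andP[].
move: pt; rewrite tE lucas_modp_eq0 lucas_mul_prime_modp mulf_eq0 expf_eq0.
rewrite -!lucas_modp_eq0 (negPf pup) orbF => /andP[_ /(t_min _ m0)].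
by rewrite tE leqNgt ltn_Pmulr // prime_gt1.
Qed.

End Companion.

Lemma padic_val_gt0 (p : nat) (x : int) : prime p -> x != 0 ->
  (p %| x)%Z -> (0 < padic_val p x)%N.
Proof.
by move=> pr_p x0; rewrite dvdzE /padic_val logn_gt0 mem_primes pr_p absz_gt0 x0.
Qed.

(** * Lucas valuations as patterns *)

Section LucasPattern.
Variables (a b : int) (p : nat).
Hypotheses (pr_p : prime p) (pb : (p %| b)%Z = false).
Hypothesis u_neq0 : forall n, (0 < n)%N -> lucas a b n != 0.
Local Notation u := (lucas a b).
Local Notation nu := (padic_val p).

Lemma lucas_val_ndvd t n : is_apparition_rank a b p t -> ~~ (t %| n)%N ->
  nu (u n) = 0%N.
Proof.
move=> ht tn; apply: padic_val_eq0; apply/negbTE.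
by rewrite (lucas_dvd_apparition _ _ _ pr_p pb _ _ ht).
Qed.

(** [u_(p k)] has valuation [nu (u p) + logn p k], which is [logn p (p * k) + nu (u p) - 1]; hence
    the value of [h1]. For [p = 2] the condition on 4 holds because [u_2 = a] is even. *)
Lemma lucas_val_ramified n : (p %| lucas_disc a b)%Z ->
  lucas_val a b p n = (val_pattern p 1 0 (nu (u p)).-1 n)%:Z.
Proof.
move=> pD; have hp := lucas_disc_apparition _ _ _ pr_p pb pD.
have [p_gt0 pu _] := hp.
have nu_gt0 : (0 < nu (u p))%N by apply: padic_val_gt0 => //; exact: u_neq0.
rewrite /lucas_val /val_pattern dvd1n; congr _%:Z.
case: ifP => [/dvdnP[k nE]|pn]; last by rewrite (lucas_val_ndvd _ _ hp) ?pn.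
have k_gt0 : (0 < k)%N by case: (k) nE.
rewrite nE mulnC lucas_val_mul //.
  by rewrite lognM // (logn_prime _ pr_p) eqxx; lia.
have [p2|p2] := eqVneq p 2; last by left; rewrite ltn_neqAle eq_sym p2 prime_gt1.
right; have : (p %| a)%Z by rewrite (lucas_disc_dvd_coef a b) // p2.
by rewrite p2 /= mulr1 mulr0 addr0 => a2; exact: (dvdz_mul a2 a2).
Qed.

Lemma lucas_val_unramified t n : is_apparition_rank a b p t ->
  coprime t p -> (2 < p)%N ->
  lucas_val a b p n = (val_pattern p t (nu (u t)) (nu (u t)) n)%:Z.
Proof.
move=> ht co_tp p_gt2; have [t_gt0 pt _] := ht.
rewrite /lucas_val /val_pattern; congr _%:Z.
case: ifP => [/dvdnP[k nE]|tn]; last by rewrite (lucas_val_ndvd _ _ ht) ?tn.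
have k_gt0 : (0 < k)%N by case: (k) nE.
rewrite nE mulnC lucas_val_mul //; last by left.
have <- : logn p (t * k) = logn p k by rewrite lognM // logn_coprime // coprime_sym.
case: ifP => [_|pn]; first by rewrite addnC.
by rewrite lognE pn !andbF addn0.
Qed.
End LucasPattern.

Lemma odd_intP (x : int) : (2 %| x)%Z = false -> exists k, x = 2 * k + 1.
Proof. by move=> x2; exists (x %/ 2)%Z; lia. Qed.

Lemma lucas_odd_apparition (a b : int) :
  (2 %| a)%Z = false -> (2 %| b)%Z = false -> is_apparition_rank a b 2 3.
Proof.
move=> a2 b2; split=> // [|[|[|[|n]]] //].
  have [[k ->] [l ->]] := (odd_intP a a2, odd_intP b b2).
  by apply/dvdzP; exists (2 * k ^+ 2 + 2 * k + l + 1); rewrite /=; ring.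
by rewrite /= mulr1 mulr0 addr0 a2.
Qed.

(** Odd multiples of 3 keep the valuation of [u_3]. For even ones the multiplication law starts from
    6, where 4 divides [u_6]; the factor 2 of 6 is counted in [logn 2 n.+1], hence the
    predecessor. *)
Lemma lucas_val_two (a b : int) n :
  (2 %| a)%Z = false -> (2 %| b)%Z = false ->
  (forall n, (0 < n)%N -> lucas a b n != 0) ->
  lucas_val a b 2 n =
  (val_pattern 2 3 (padic_val 2 (lucas a b 3)) (padic_val 2 (lucas a b 6)).-1 n)%:Z.
Proof.
move=> a2 b2 u_neq0; have h3 := lucas_odd_apparition _ _ a2 b2.
have d3 : (2 %| lucas a b 3)%Z by case: h3.
have d6 : (4 %| lucas a b 6)%Z.
  have -> : lucas a b 6 = lucas a b 3 * (a * (a ^+ 2 + 3 * b)) by rewrite /=; ring.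
  rewrite (_ : 4 = 2%:Z * 2) // dvdz_mul // dvdz_mull //.
  have [[k ->] [l ->]] := (odd_intP a a2, odd_intP b b2).
  by apply/dvdzP; exists (2 * k ^+ 2 + 2 * k + 3 * l + 2); ring.
have nu6 : (0 < padic_val 2 (lucas a b 6))%N.
  by apply: padic_val_gt0 => //; [exact: u_neq0 | exact: dvdz_trans d6].
rewrite /lucas_val /val_pattern; congr _%:Z.
case: ifP => [/dvdnP[k nE]|tn]; last by rewrite (lucas_val_ndvd _ _ _ _ _ _ _ h3) ?tn.
have k_gt0 : (0 < k)%N by case: (k) nE.
rewrite nE mulnC Gauss_dvdr //; case: ifPn => [/dvdnP[j kE]|k2].
  have j_gt0 : (0 < j)%N by move: k_gt0; rewrite kE muln_gt0 => /andP[].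
  rewrite kE (_ : 3 * (j * 2) = 6 * j)%N; last by lia.
  rewrite lucas_val_mul //; last by right; rewrite dvdz_mull.
    by rewrite lognM // (_ : logn 2 6 = 1%N) //; lia.
  exact: dvdz_trans d6.
by rewrite lucas_val_mul_coprime.
Qed.

Theorem theorem1p4 (a b : int) (p : nat) :
  lucas_nondegenerate a b -> prime p -> ~~ (p %| b)%Z ->
  exists r : nat,
    p_regular_rank p (lucas_val a b p) r /\
    ((p %| lucas_disc a b)%Z ->
       (((p = 2%N \/ p = 3%N) /\ padic_val p (lucas a b p) = 1%N \/ (5 <= p)%N) ->
          r = 2%N) /\
       ((p = 2%N \/ p = 3%N) /\ padic_val p (lucas a b p) <> 1%N ->
          r = 3%N)) /\
    (~~ (p %| lucas_disc a b)%Z ->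
       (p = 2%N /\
        padic_val 2 (lucas a b 6) <> (padic_val 2 (lucas a b 3) + 1)%N ->
          r = 5%N) /\
       ((2 < p)%N \/
        p = 2%N /\
        padic_val 2 (lucas a b 6) = (padic_val 2 (lucas a b 3) + 1)%N ->
          exists2 t : nat, is_apparition_rank a b p t & r = (t + 1)%N)).
Proof.
move=> nd pr_p /negbTE pb; have u_neq0 n := @lucas_neq0 a b n nd.
have [pD|pD] := boolP (p %| lucas_disc a b)%Z.
  have [p_gt0 pu _] := lucas_disc_apparition a b p pr_p pb pD.
  have nu_gt0 : (0 < padic_val p (lucas a b p))%N.
    by apply: padic_val_gt0 => //; exact: u_neq0.
  (* Here [t = 1] and [h0 = 0]: the rank is 2 or 3 according to whether [u_p] has valuation 1. *)
  exists (1 + (0 != (padic_val p (lucas a b p)).-1).+1)%N; split.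
    apply: val_pattern_rank => // [|n]; first exact: coprime1n.
    exact: lucas_val_ramified.
  split=> // _; split=> [[[_ ->]//|p_ge5]|[_ nu1]].
    by rewrite (lucas_disc_val_prime a b).
  by have -> : (0 != (padic_val p (lucas a b p)).-1)%N by lia.
have [p2|p2] := eqVneq p 2.
  rewrite p2 in pb pD *.
  have a2 : (2 %| a)%Z = false.
    apply: contraNF pD => a2.
    by rewrite /lucas_disc rpredD ?expr2 ?dvdz_mulr.
  have h3 := lucas_odd_apparition a b a2 pb.
  set h0 := padic_val 2 (lucas a b 3); set h6 := padic_val 2 (lucas a b 6).
  (* As [h6] is positive, [h0 = h6.-1] is the equality of the statement; the rank is then 4, and 5
     otherwise. *)
  exists (3 + (h0 != h6.-1).+1)%N; split.
    by apply: val_pattern_rank => // n; apply: lucas_val_two.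
  split=> // _.
  have h6_gt0 : (0 < h6)%N.
    apply: padic_val_gt0 => //; first exact: u_neq0.
    by rewrite (lucas_dvd_apparition _ _ _ _ _ _ _ h3).
  split=> [[_ h]|[//|[_ h]]]; first by have -> : h0 != h6.-1 by lia.
  by exists 3%N => //; rewrite h addn1 eqxx.
have p_gt2 : (2 < p)%N by rewrite ltn_neqAle eq_sym p2 prime_gt1.
have [t ht] := exists_apparition_rank a b p pr_p pb.
have co_tp := apparition_coprime a b p pr_p t ht pD.
have [t_gt0 _ _] := ht.
exists (t + (padic_val p (lucas a b t) != padic_val p (lucas a b t)).+1)%N; split.
  by apply: val_pattern_rank => // n; apply: lucas_val_unramified.
split=> //.
by move=> _; split=> [[p2']|_]; [rewrite p2' in p2 | exists t; rewrite ?eqxx].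
Qed.
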